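(* Suppose $\frac nk\ge6$ and $\theta\in[k]^n$ is balanced. Let $\mathcal M:\{0,1\}^{n\times n}\to\mathbf M_{n\times k}$ be a symmetric $(\epsilon,\delta)$-node DP mechanism. For any adjacency matrix $A\in\{0,1\}^{n\times n}$ and any $\xi\in(0,1/3)$, $$\mathbb P\left(\widetilde{\mathcal L}(\mathcal M(A),\theta)\le\xi\right)\le\frac{1}{(1-\xi)(1+(k-1)e^{-2\epsilon})}+\frac{2(k-1)\delta}{1-\xi}.$$
   Context: $\mathbf M_{n\times k}$ is the set of $n\times k$ matrices with exactly one $1$ in each row and $0$ otherwise; $\hat\theta\in[k]^n$ is identified with its one-hot encoding in $\mathbf M_{n\times k}$. $\theta$ is balanced if $|\{i:\theta_i=j\}|=n/k$ for all $j\in[k]$. Adjacency matrices are those of unweighted undirected graphs on $[n]$. Two graphs are node-adjacent if one can be obtained from the other by rewiring at most one node (changing the corresponding row and column of the adjacency matrix). A randomized mechanism $\mathcal M$ is $(\epsilon,\delta)$-node DP if $\mathbb P(\mathcal M(A)\in S)\le e^\epsilon\mathbb P(\mathcal M(A')\in S)+\delta$ for all node-adjacent $A,A'$ and all measurable $S$. $\mathcal M$ is symmetric if for every $\hat\theta$, every $A\in\{0,1\}^{n\times n}$ and every deterministic $n\times n$ permutation matrix $L$, $\mathbb P(\mathcal M(A)=\hat\theta)=\mathbb P(\mathcal M(LAL^T)=L\hat\theta)$. With $C_j=\{i:\theta_i=j\}$ and $S_k$ the permutation group of $[k]$, $\widetilde{\mathcal L}(\hat\theta,\theta)=\min_{\sigma\in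 S_k}\max_{j\in[k]}\frac{2}{|C_j|}\sum_{i\in C_j}\mathbf 1\{\sigma(\hat\theta_i)\ne j\}$. *)

(* Defs.v *)
From HB Require Import structures.
From mathcomp Require Import all_boot all_order all_algebra all_fingroup.
From mathcomp Require Import all_classical all_reals all_analysis.

Set Implicit Arguments.
Unset Strict Implicit.
Unset Printing Implicit Defensive.

Import Order.TTheory GRing.Theory Num.Theory.
Local Open Scope classical_set_scope.
Local Open Scope ring_scope.

(* {0,1}-matrices are matrices over bool. The ring structure of bool is that
   of the two-element field; the only products formed below have a permutation
   matrix as a factor, so no two nonzero terms are ever added and the result
   is the same as over the integers. *)

Definition labeling (n k : nat) : finType := {ffun 'I_n -> 'I_k}.

(* The n x k matrices with exactly one 1 in each row; [onehot_inj] and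
   [onehot_range] justify identifying them with labelings. *)
Definition onehot_matrices (n k : nat) : {set 'M[bool]_(n, k)} :=
  [set X : 'M[bool]_(n, k) | [forall i, #|[set j | X i j]| == 1%N]]%SET.

Definition onehot (n k : nat) (t : labeling n k) : 'M[bool]_(n, k) :=
  \matrix_(i, j) (t i == j).

Lemma onehot_inj (n k : nat) : injective (@onehot n k).
Proof.
move=> t u /matrixP tu; apply/ffunP => i.
by have := tu i (t i); rewrite !mxE eqxx => /esym/eqP ->.
Qed.

Lemma onehot_range (n k : nat) :
  [set onehot t | t : labeling n k]%SET = onehot_matrices n k.
Proof.
apply/setP => X; rewrite inE; apply/imsetP/forallP => [[t _ ->] i|X1].
  rewrite (_ : finset _ = [set t i]%SET) ?cards1//.
  by apply/setP => j; rewrite !inE mxE eq_sym.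
have X2 i : {j | [set j | X i j]%SET = [set j]%SET}.
  by apply: cid; have /cards1P := X1 i.
exists [ffun i => sval (X2 i)] => //; apply/matrixP => i j.
rewrite mxE ffunE; case: (X2 i) => l /= /setP /(_ j).
by rewrite !inE eq_sym.
Qed.

Definition community (n k : nat) (t : labeling n k) (j : 'I_k) : {set 'I_n} :=
  [set i | t i == j]%SET.

Definition balanced (n k : nat) (t : labeling n k) : Prop :=
  forall j : 'I_k, #|community t j|%:R = n%:R / k%:R :> rat.

Definition adjacency (n : nat) (A : 'M[bool]_n) : Prop :=
  A^T = A /\ forall i, A i i = false.

(* [s] is the set of rewired nodes. *)
Definition node_adjacent (n : nat) (A A' : 'M[bool]_n) : Prop :=
  exists s : {set 'I_n}, (#|s| <= 1)%N /\
    forall u v, u \notin s -> v \notin s -> A u v = A' u v.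

Section Mechanisms.
Context (R : realType) (d : measure_display) (T : measurableType d).
Context (P : probability T R) (n k : nat).

(* A randomized mechanism is a family of random variables, one for each input
   matrix, on a probability space (T, P); the finite output space carries its
   discrete sigma-algebra. *)
Definition randomized_mechanism (M : 'M[bool]_n -> T -> labeling n k) : Prop :=
  forall (A : 'M[bool]_n) (S : set (labeling n k)), measurable (M A @^-1` S).

Definition node_dp (M : 'M[bool]_n -> T -> labeling n k) (eps delta : R) :
    Prop :=
  forall A A' : 'M[bool]_n, adjacency A -> adjacency A' ->
  node_adjacent A A' -> forall S : set (labeling n k),
  (P (M A @^-1` S) <= (expR eps)%:E * P (M A' @^-1` S) + delta%:E)%E.

(* The input [A] ranges over all {0,1}-matrices, not only adjacency ones. *)
Definition symmetric_mechanism (M : 'M[bool]_n -> T -> labeling n k) : Prop :=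
  forall (t : labeling n k) (A L : 'M[bool]_n), is_perm_mx L ->
  P [set w | M A w = t] =
  P [set w | onehot (M (L *m A *m L^T) w) = L *m onehot t].

End Mechanisms.

(* The default values of the iterated operators are harmless: the terms of the
   maximum are nonnegative, and the default of the minimum is one of its terms. *)
Definition max_error (R : realType) (n k : nat) (t' t : labeling n k)
    (s : 'S_k) : R :=
  \big[Num.max/0]_(j < k)
    (2 / #|community t j|%:R * \sum_(i in community t j) (s (t' i) != j)%:R).

Definition Ltilde (R : realType) (n k : nat) (t' t : labeling n k) : R :=
  \big[Num.min/max_error R t' t 1%g]_(s : 'S_k) max_error R t' t s.

(* Main.v *)
Require Import Defs.
From HB Require Import structures.
From mathcomp Require Import all_boot all_order all_algebra all_fingroup.
From mathcomp Require Import all_classical all_reals all_analysis.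
From mathcomp Require Import zify ring lra.

Set Implicit Arguments.
Unset Strict Implicit.
Unset Printing Implicit Defensive.

Import Order.TTheory GRing.Theory Num.Theory.
Local Open Scope classical_set_scope.
Local Open Scope ring_scope.

(** Exchanging the positions of two nodes [u] and [v] in the graph rewires only
these two nodes, so by privacy it changes the output law by a factor [e^(2 eps)]
and an additive slack at most ([law_swap]); by symmetry it also exchanges the
output labels of [u] and [v].  Hence a mechanism which often recovers [theta]
must often output [theta] with [u] and [v] exchanged, and there are too many
such wrong outputs.

To count them, fix a node [u].  A labeling that errs on fewer than half of each
community determines the permutation of the labels that matches it to [theta]
([decodes_inj]), so the events 'u receives label l after matching', for [l] in
['I_k], are disjoint and their probabilities add up to at most 1
([decoded_mass]).  Call a labeling accurate when its loss is at most [xi].  As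
[xi < 1/3] and communities have at least 6 nodes, one exchange applied to an
accurate labeling leaves fewer than half of each community wrong.  Therefore,
when [v] lies in community [l], the event 'accurate, with u and v both correct'
is sent by the exchange into the event that [u] receives [l] ([accurate_swap]).

An accurate labeling is correct on a proportion at least [1 - xi/2] of each
community, so a proportion at least [(1 - xi/2)^2 >= 1 - xi] of the pairs
[(u, v)] between two communities are both correct ([accurate_pairs]).
Averaging over [u] in a fixed community and [v] in each of the [k - 1] other
ones gives [(1 - xi) p (1 + (k - 1) e^(-2 eps)) <= 1 + (k - 1) c], where [p] is
the probability of being accurate and [c = (e^(-2 eps) + e^(-eps)) delta]
([accurate_mass]).  The slack term is finally compared with that of the theorem
in [swap_slack_bound], whatever the sign of [eps]. *)

(** * Relabeling nodes *)

Lemma ler_sum_widen (R : numDomainType) (I : finType) (p p' : pred I)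
    (F : I -> R) : (forall i, p i -> p' i) -> (forall i, 0 <= F i) ->
  \sum_(i | p i) F i <= \sum_(i | p' i) F i.
Proof.
move=> pp' F0; rewrite big_mkcond [leRHS]big_mkcond; apply: ler_sum => i _.
by case: ifPn => [/pp'->//|_]; case: ifP.
Qed.

Definition relabel (n k : nat) (s : 'S_n) (t : labeling n k) : labeling n k :=
  [ffun i => t (s i)].

Definition relabel_graph (n : nat) (s : 'S_n) (A : 'M[bool]_n) : 'M[bool]_n :=
  \matrix_(u, v) A (s u) (s v).

Lemma conj_perm_mx (n : nat) (s : 'S_n) (A : 'M[bool]_n) :
  perm_mx s *m A *m (perm_mx s)^T = relabel_graph s A.
Proof.
rewrite tr_perm_mx -row_permE -col_permE.
by apply/matrixP => u v; rewrite !mxE.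
Qed.

Lemma onehot_relabel (n k : nat) (s : 'S_n) (t : labeling n k) :
  perm_mx s *m onehot t = onehot (relabel s t).
Proof. by rewrite -row_permE; apply/matrixP => u v; rewrite !mxE ffunE. Qed.

Lemma relabel_adjacency (n : nat) (s : 'S_n) (A : 'M[bool]_n) :
  adjacency A -> adjacency (relabel_graph s A).
Proof.
move=> [AT A0]; split=> [|i]; last by rewrite mxE.
by apply/matrixP => u v; rewrite !mxE -{1}AT mxE.
Qed.

Lemma tperm_relabelK (n k : nat) (u v : 'I_n) :
  involutive (@relabel n k (tperm u v)).
Proof. by move=> t; apply/ffunP => i; rewrite !ffunE tpermK. Qed.

(** The graph halfway has the edges of the exchanged graph at [u], and those of
[A] elsewhere: it is one rewiring of [u] away from [A], and one rewiring of [v]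
away from the exchanged graph. *)
Lemma swap_graph_path (n : nat) (A : 'M[bool]_n) (u v : 'I_n) :
  adjacency A -> exists B : 'M[bool]_n,
    [/\ adjacency B, node_adjacent (relabel_graph (tperm u v) A) B
      & node_adjacent B A].
Proof.
move=> adjA; have [AT A0] := adjA.
have [BT B0] := relabel_adjacency (tperm u v) adjA.
set B := relabel_graph _ _ in BT B0 *.
have BS x y : B x y = B y x by move/matrixP/(_ y x): BT; rewrite [LHS]mxE.
have AS x y : A x y = A y x by move/matrixP/(_ y x): AT; rewrite [LHS]mxE.
exists (\matrix_(x, y) if (x == u) || (y == u) then B x y else A x y).
split.
- split=> [|i]; last by rewrite mxE A0 B0 if_same.
  by apply/matrixP => x y; rewrite [LHS]mxE [LHS]mxE [RHS]mxE orbC BS AS.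
- exists [set v]%SET; rewrite cards1; split=> // x y; rewrite !inE !mxE.
  case: (boolP (x == u)) => //= xu xv; case: (boolP (y == u)) => //= yu yv.
  by rewrite !tpermD// eq_sym.
- exists [set u]%SET; rewrite cards1; split=> // x y; rewrite !inE !mxE.
  by move=> /negbTE-> /negbTE->.
Qed.

(** * The output law under an exchange of two nodes *)

Section Law.
Context (R : realType) (d : measure_display) (T : measurableType d).
Context (P : probability T R) (n k : nat).
Variable M : 'M[bool]_n -> T -> labeling n k.

Definition law (A : 'M[bool]_n) (t : labeling n k) : R :=
  fine (P [set w | M A w = t]).

Hypothesis Mmeas : randomized_mechanism M.

Lemma law_sum (A : 'M[bool]_n) (Q : {set labeling n k}) :
  P (M A @^-1` [set` Q]) = (\sum_(t in Q) law A t)%:E.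
Proof.
have mF t : measurable [set w | M A w = t] by exact: (Mmeas A [set t]).
rewrite (_ : _ @^-1` _ = \bigcup_(t in [set` Q]) [set w | M A w = t]); last first.
  apply/seteqP; split=> w /=; first by move=> wQ; exists (M A w).
  by move=> [t tQ /= ->].
rewrite measure_fin_bigcup//; last by move=> t s _ _ [w [/= <- <-]].
rewrite (fsbigE (enum Q)) ?enum_uniq//; first last.
- by move=> t /= tQ; rewrite mem_enum tQ.
- by move=> t /=; rewrite mem_enum.
rewrite -sumEFin big_enum_cond/=; apply: eq_big => [t|t tQ].
  by rewrite andb_idr// => tQ; rewrite inE.
by rewrite fineK// fin_num_measure.
Qed.

Lemma law_ge0 A t : 0 <= law A t.
Proof. by rewrite /law fine_ge0. Qed.

Lemma law_total A : \sum_t law A t = 1.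
Proof.
apply: EFin_inj; rewrite -[RHS](@probability_setT _ _ _ P).
rewrite (_ : setT = M A @^-1` [set` [set: labeling n k]%SET]).
  by rewrite law_sum; congr EFin; apply: eq_bigl => t; rewrite inE.
by apply/seteqP; split=> w //= _; rewrite inE.
Qed.

Lemma law_relabel (s : 'S_n) A t : symmetric_mechanism P M ->
  law A t = law (relabel_graph s A) (relabel s t).
Proof.
move=> Msym; rewrite /law (Msym t A (perm_mx s)); last exact: perm_mx_is_perm.
rewrite conj_perm_mx onehot_relabel; congr (fine (P _)).
by apply/seteqP; split=> w /= => [/onehot_inj|->].
Qed.

Variables eps delta : R.
Hypothesis Mdp : node_dp P M eps delta.

Lemma law_dp (A A' : 'M[bool]_n) (Q : {set labeling n k}) :
  adjacency A -> adjacency A' -> node_adjacent A A' ->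
  \sum_(t in Q) law A t <= expR eps * \sum_(t in Q) law A' t + delta.
Proof.
move=> adjA adjA' AA'; have := Mdp adjA adjA' AA' [set` Q].
by rewrite !law_sum -EFinM -EFinD lee_fin.
Qed.

(** Privacy for the empty event reads [0 <= delta]. *)
Lemma node_dp_delta_ge0 (A : 'M[bool]_n) : adjacency A -> 0 <= delta.
Proof.
move=> adjA; have AA : node_adjacent A A.
  by exists finset.set0; rewrite cards0.
by have := @law_dp A A finset.set0 adjA adjA AA; rewrite !big_set0 mulr0 add0r.
Qed.

(** Symmetry carries [Q] to the exchanged graph, then two privacy steps return
to [A].  Dividing by [e^(2 eps)] turns their total slack [(1 + e^eps) delta]
into the one stated. *)
Lemma law_swap (A : 'M[bool]_n) (u v : 'I_n) (Q Q' : {set labeling n k}) :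
  symmetric_mechanism P M -> adjacency A ->
  (forall t, t \in Q -> relabel (tperm u v) t \in Q') ->
  expR (- (2 * eps)) * \sum_(t in Q) law A t <=
    \sum_(t in Q') law A t +
    (expR (- (2 * eps)) + expR (- eps)) * delta.
Proof.
move=> Msym adjA QQ'; have [B [adjB LB BA]] := swap_graph_path u v adjA.
have adjL := relabel_adjacency (tperm u v) adjA.
(* Symmetry step: the event [Q] becomes its relabeling, a part of [Q']. *)
have H1 : \sum_(t in Q) law A t <=
          \sum_(t in Q') law (relabel_graph (tperm u v) A) t.
  rewrite (eq_bigr _ (fun t _ => law_relabel (tperm u v) A t Msym)).
  rewrite (reindex_inj (inv_inj (@tperm_relabelK n k u v)))/=.
  under eq_bigr do rewrite tperm_relabelK.
  apply: ler_sum_widen => [t /QQ'|t]; last exact: law_ge0.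
  by rewrite tperm_relabelK.
have H2 := law_dp Q' adjL adjB LB; have H3 := law_dp Q' adjB adjA BA.
have e0 := expR_gt0 eps; have g0 := expR_gt0 (- eps).
have -> : expR (- (2 * eps)) = expR (- eps) ^+ 2.
  by rewrite expr2 -expRD; congr expR; ring.
have ge1 : expR (- eps) * expR eps = 1 by rewrite -expRD addNr expR0.
move: (\sum_(t in Q) _) (\sum_(t in Q') law (relabel_graph _ _) _)
  (\sum_(t in Q') law B _) (\sum_(t in Q') law A _) H1 H2 H3 => q l b a H1 H2 H3.
move: (expR eps) (expR (- eps)) e0 g0 ge1 H2 H3 => y x y0 x0 xy H2 H3.
(* With [x = 1 / y], each privacy step is multiplied by [x]. *)
have H4 : x * b <= a + x * delta.
  by rewrite -[a]mul1r -xy -mulrA -mulrDr ler_pM2l.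
have H5 : x * q <= b + x * delta.
  rewrite -[b]mul1r -xy -mulrA -mulrDr ler_pM2l//; exact: le_trans H1 H2.
have H6 : x * (x * q) <= x * (b + x * delta) by rewrite ler_pM2l.
rewrite expr2; lra.
Qed.

End Law.

(** * Matching a labeling to the ground truth *)

Section Decoding.
Variables (n k : nat) (theta : labeling n k).

Definition errors (t : labeling n k) (s : 'S_k) (j : 'I_k) : {set 'I_n} :=
  [set i in community theta j | s (t i) != j]%SET.

Definition hits (t : labeling n k) (s : 'S_k) (j : 'I_k) : {set 'I_n} :=
  [set i in community theta j | s (t i) == j]%SET.

Lemma card_hits t s j : (#|hits t s j| + #|errors t s j|)%N = #|community theta j|.
Proof.
rewrite -(cardsID [set i | s (t i) == j]%SET (community theta j)).
by congr (_ + _)%N; apply: eq_card => i; rewrite !inE// andbC.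
Qed.

Definition decodes (t : labeling n k) (s : 'S_k) : bool :=
  [forall j, 2 * #|errors t s j| < #|community theta j|]%N.

(** Two matchings with a minority of errors agree with the truth at a common
node of each community [j], and the label of that node is the preimage of [j]
under both. *)
Lemma decodes_inj t s1 s2 : decodes t s1 -> decodes t s2 -> s1 = s2.
Proof.
move=> /forallP e1 /forallP e2.
suff inv j : (s1^-1)%g j = (s2^-1)%g j.
  by apply: invg_inj; apply/permP.
have : (0 < #|hits t s1 j :&: hits t s2 j|)%N.
  have := cardsUI (hits t s1 j) (hits t s2 j).
  have : (#|hits t s1 j :|: hits t s2 j| <= #|community theta j|)%N.
    apply: subset_leq_card; apply/fintype.subsetP => i.
    by rewrite !inE => /orP[] /andP[].
  have := card_hits t s1 j; have := card_hits t s2 j.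
  by have := e1 j; have := e2 j; lia.
rewrite card_gt0 => /set0Pn[i]; rewrite !inE => /andP[/andP[_ /eqP h1] /andP[_ /eqP h2]].
by rewrite -{1}h1 -{1}h2 !permK.
Qed.

(** At most one of [u] and [v] lies in community [j], so at most one new error
appears there. *)
Lemma errors_swap t s u v j : theta u != theta v ->
  (#|errors (relabel (tperm u v) t) s j| <= #|errors t s j|.+1)%N.
Proof.
move=> uv.
have [w sub] : exists w, errors (relabel (tperm u v) t) s j \subset w |: errors t s j.
  exists (if theta u == j then u else v); apply/fintype.subsetP => i.
  rewrite !inE ffunE => /andP[/eqP ij].
  case: tpermP => [iu|iv|_ _ ->]; last by rewrite ij eqxx orbT.
  - by rewrite -ij iu !eqxx.
  - by rewrite -ij iv (negbTE uv) !eqxx.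
by apply: leq_trans (subset_leq_card sub) _; rewrite cardsU1; case: (_ \notin _).
Qed.

Definition decoded_as (i : 'I_n) (l : 'I_k) : {set labeling n k} :=
  [set t | [exists s, decodes t s && (s (t i) == l)]]%SET.

Lemma decoded_as_disjoint (i : 'I_n) (l l' : 'I_k) t :
  t \in decoded_as i l -> t \in decoded_as i l' -> l = l'.
Proof.
rewrite !inE => /existsP[s /andP[ds /eqP <-]] /existsP[s' /andP[ds' /eqP <-]].
by rewrite (decodes_inj ds ds').
Qed.

(** * Accurate labelings *)

Section Threshold.
Variables (R : realFieldType) (xi : R).
Hypothesis xi13 : 0 < xi < 3^-1.
Hypothesis large : forall j, (6 <= #|community theta j|)%N.

(** The loss of the matching [s] is at most [xi], with the denominators
cleared. *)
Definition within (t : labeling n k) (s : 'S_k) : bool :=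
  [forall j, 2 * #|errors t s j|%:R <= xi * #|community theta j|%:R].

Definition accurate : {set labeling n k} := [set t | [exists s, within t s]]%SET.

Definition accurate_at (u v : 'I_n) : {set labeling n k} :=
  [set t | [exists s, [&& within t s, s (t u) == theta u & s (t v) == theta v]]]%SET.

Lemma within_errors t s j : within t s -> (6 * #|errors t s j| < #|community theta j|)%N.
Proof.
move=> /forallP/(_ j) le; rewrite -(ltr_nat R) natrM.
have c0 : 0 < #|community theta j|%:R :> R by rewrite ltr0n; have := large j; lia.
case/andP: xi13 => _ xi1; have : xi * #|community theta j|%:R < 3^-1 * #|community theta j|%:R.
  by rewrite ltr_pM2r.
lra.
Qed.

Lemma within_decodes t s : within t s -> decodes t s.
Proof. by move=> /within_errors w; apply/forallP => j; have := w j; lia. Qed.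

Lemma within_hits t s j : within t s ->
  (1 - xi / 2) * #|community theta j|%:R <= #|hits t s j|%:R.
Proof.
by move=> /forallP/(_ j); rewrite -(card_hits t s j) natrD; lra.
Qed.

Lemma accurate_decoded (u : 'I_n) t :
  t \in accurate_at u u -> t \in decoded_as u (theta u).
Proof.
rewrite !inE => /existsP[s /and3P[w h _]]; apply/existsP; exists s.
by rewrite within_decodes.
Qed.

(** Fewer than a sixth of a community of at least 6 nodes, plus one, is fewer
than half of it. *)
Lemma accurate_swap (u v : 'I_n) t : theta u != theta v ->
  t \in accurate_at u v -> relabel (tperm u v) t \in decoded_as u (theta v).
Proof.
move=> uv; rewrite !inE => /existsP[s /and3P[w _ h]]; apply/existsP; exists s.
rewrite ffunE tpermL h andbT; apply/forallP => j.
have := errors_swap t s j uv; have := within_errors j w; have := large j; lia.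
Qed.

(** A matching [s] within [xi] is correct on all pairs of [hits t s j] and
[hits t s l], and [(1 - xi/2)^2 >= 1 - xi]. *)
Lemma accurate_pairs (j l : 'I_k) t : t \in accurate ->
  (1 - xi) * (#|community theta j|%:R * #|community theta l|%:R) <=
  \sum_(u in community theta j) \sum_(v in community theta l)
     (t \in accurate_at u v)%:R.
Proof.
rewrite inE => /existsP[s w].
apply: (@le_trans _ _ (#|hits t s j|%:R * #|hits t s l|%:R)).
  apply: le_trans (_ : ((1 - xi / 2) * #|community theta j|%:R) *
                       ((1 - xi / 2) * #|community theta l|%:R) <= _).
    rewrite mulrACA ler_wpM2r ?mulr_ge0// -expr2.
    have := sqr_ge0 (xi / 2); rewrite !expr2; lra.
  case/andP: xi13 => xi0 xi1.
  by apply: ler_pM; rewrite ?within_hits// mulr_ge0//; lra.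
rewrite -[X in X%:R * _]sum1_card natr_sum big_distrl/= [leRHS]big_mkcond/= big_mkcond/=.
apply: ler_sum => u _; rewrite !inE mul1r.
have [uj|//] := eqVneq (theta u) j; rewrite /=.
case: eqP => [hu|_]; last by apply: sumr_ge0.
rewrite -sum1_card natr_sum [leRHS]big_mkcond/= big_mkcond/=.
apply: ler_sum => v _; rewrite !inE.
have [vl|//] := eqVneq (theta v) l; rewrite /=.
case: eqP => [hv|_ //]; case: existsP => // -[].
by exists s; rewrite w uj vl hu hv !eqxx.
Qed.

Lemma accurate_single (j : 'I_k) t : t \in accurate ->
  (1 - xi) * #|community theta j|%:R <=
  \sum_(u in community theta j) (t \in accurate_at u u)%:R.
Proof.
rewrite inE => /existsP[s w].
apply: (@le_trans _ _ #|hits t s j|%:R).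
  apply: le_trans (within_hits j w); case/andP: xi13 => xi0 _.
  by rewrite ler_wpM2r//; lra.
rewrite -sum1_card natr_sum [leRHS]big_mkcond/= big_mkcond/=.
apply: ler_sum => u _; rewrite !inE.
have [uj|//] := eqVneq (theta u) j; rewrite /=.
case: eqP => [hu|_ //]; case: existsP => // -[].
by exists s; rewrite w uj hu !eqxx.
Qed.

(** * Counting the disjoint wrong outputs *)

Section Weights.
Variable q : labeling n k -> R.
Hypothesis q_ge0 : forall t, 0 <= q t.
Hypothesis q_total : \sum_t q t = 1.

Let mass (Q : {set labeling n k}) : R := \sum_(t in Q) q t.

Lemma decoded_mass (i : 'I_n) : \sum_l mass (decoded_as i l) <= 1.
Proof.
rewrite -q_total /mass; under eq_bigr do rewrite big_mkcond/=.
rewrite exchange_big/=; apply: ler_sum => t _.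
have [[l tl]|none] := pselect (exists l, t \in decoded_as i l).
  rewrite (bigD1 l)//= tl big1 ?addr0// => l' l'l.
  by case: ifP => // /(decoded_as_disjoint tl) ll'; rewrite ll' eqxx in l'l.
by rewrite big1// => l _; case: ifP => // tl; case: none; exists l.
Qed.

Lemma mass_indicator (Q : {set labeling n k}) :
  mass Q = \sum_t q t * (t \in Q)%:R.
Proof. by rewrite /mass big_mkcond; apply: eq_bigr => t _; rewrite mulr_natr mulrb. Qed.

(** Double counting of the pairs formed of a labeling and an index. *)
Lemma mass_lower (Q : {set labeling n k}) (I : finType) (p : pred I)
    (F : I -> {set labeling n k}) (a : R) :
  (forall t, t \in Q -> a <= \sum_(i | p i) (t \in F i)%:R) ->
  a * mass Q <= \sum_(i | p i) mass (F i).
Proof.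
move=> aF; under [leRHS]eq_bigr do rewrite mass_indicator.
rewrite exchange_big/= mulr_sumr big_mkcond/=; apply: ler_sum => t _.
rewrite -mulr_sumr; case: ifPn => [tQ|_].
  by rewrite mulrC ler_wpM2l// aF.
by rewrite mulr_ge0// sumr_ge0.
Qed.

Variables (m : nat) (g c : R).
Hypothesis card_community : forall j, #|community theta j| = m.
Hypothesis g_ge0 : 0 <= g.
Hypothesis mass_swap : forall (u v : 'I_n) (Q Q' : {set labeling n k}),
  (forall t, t \in Q -> relabel (tperm u v) t \in Q') ->
  g * mass Q <= mass Q' + c.

Lemma decoded_mass_own (j : 'I_k) :
  m%:R * ((1 - xi) * mass accurate) <=
  \sum_(u in community theta j) mass (decoded_as u j).
Proof.
rewrite mulrA [m%:R * _]mulrC -(card_community j).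
apply: le_trans (mass_lower (@accurate_single j)) _.
apply: ler_sum => u; rewrite inE => /eqP uj; apply: ler_sum_widen => // t.
by move=> /accurate_decoded; rewrite uj.
Qed.

(** Exchanging [u] with any [v] of community [l] bounds [mass (decoded_as u l)]
from below; averaging over [v], and not choosing one, makes the proportion
[1 - xi] of correct pairs appear. *)
Lemma decoded_mass_other (j l : 'I_k) : j != l ->
  m%:R * (g * ((1 - xi) * mass accurate) - c) <=
  \sum_(u in community theta j) mass (decoded_as u l).
Proof.
move=> jl; have m0 : 0 < m%:R :> R.
  by rewrite ltr0n -(card_community j); have := large j; lia.
rewrite -(ler_pM2l m0) [leRHS]mulr_sumr.
have pairs : (1 - xi) * (m%:R * m%:R) * mass accurate <=
    \sum_(u in community theta j) \sum_(v in community theta l)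
      mass (accurate_at u v).
  rewrite pair_big_dep/=; apply: mass_lower => t.
  rewrite -{1}(card_community j) -(card_community l) => /(accurate_pairs j l).
  by rewrite pair_big_dep.
have : g * ((1 - xi) * (m%:R * m%:R) * mass accurate) <=
    \sum_(u in community theta j)
      (m%:R * mass (decoded_as u l) + m%:R * c).
  apply: le_trans (ler_wpM2l g_ge0 pairs) _; rewrite mulr_sumr.
  apply: ler_sum => u; rewrite inE => /eqP uj; rewrite mulr_sumr -mulrDr.
  rewrite -[X in X%:R * _](card_community l) mulr_natl -sumr_const.
  apply: ler_sum => v; rewrite inE => /eqP vl; apply: (@mass_swap u v) => t.
  by rewrite -vl; apply: accurate_swap; rewrite uj vl.
rewrite big_split/= sumr_const card_community -[_ *+ m]mulr_natl; lra.
Qed.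

(** For each node of community [j] the masses of the labels it may decode to add
up to at most 1; the label [j] contributes the term 1 of the left factor, and
the [k - 1] others contribute [g] each. *)
Lemma accurate_mass : (0 < k)%N ->
  (1 - xi) * mass accurate * (1 + (k%:R - 1) * g) <= 1 + (k%:R - 1) * c.
Proof.
move=> k0; pose j := Ordinal k0.
have m0 : 0 < m%:R :> R.
  by rewrite ltr0n -(card_community j); have := large j; lia.
have total : \sum_l \sum_(u in community theta j) mass (decoded_as u l) <= m%:R.
  rewrite exchange_big/= -[in leRHS](card_community j) -sum1_card natr_sum.
  by apply: ler_sum => u _; apply: decoded_mass.
rewrite (bigD1 j)//= in total.
have others : (k%:R - 1) * (m%:R * (g * ((1 - xi) * mass accurate) - c)) <=
    \sum_(l | l != j) \sum_(u in community theta j) mass (decoded_as u l).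
  have -> : k%:R - 1 = #|[pred l : 'I_k | l != j]|%:R :> R.
    by rewrite cardC1 card_ord -[in LHS](prednK k0) -natr1 addrK.
  rewrite [leLHS]mulr_natl -sumr_const; apply: ler_sum => l lj.
  by apply: decoded_mass_other; rewrite eq_sym.
by have own := decoded_mass_own j; rewrite -(ler_pM2l m0); lra.
Qed.

End Weights.
End Threshold.
End Decoding.

(** * From the loss to accurate labelings *)

Lemma Ltilde_min (R : realType) (n k : nat) (t' t : labeling n k) :
  exists s : 'S_k, Ltilde R t' t = max_error R t' t s.
Proof.
rewrite /Ltilde; elim/big_ind: _ => [|x y [s ->] [s' ->]|s _]; [by exists 1%g| |by exists s].
by rewrite /Num.min; case: ifP => _; [exists s|exists s'].
Qed.

Lemma Ltilde_accurate (R : realType) (n k : nat) (t theta : labeling n k) (xi : R) :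
  (forall j, (0 < #|community theta j|)%N) ->
  Ltilde R t theta <= xi -> t \in accurate theta xi.
Proof.
move=> pos; have [s ->] := Ltilde_min R t theta => le_xi.
rewrite inE; apply/existsP; exists s; apply/forallP => j.
have c0 : 0 < #|community theta j|%:R :> R by rewrite ltr0n.
rewrite -ler_pdivrMr// mulrAC; apply: le_trans le_xi.
rewrite /max_error; apply: le_trans (le_bigmax _ _ j).
rewrite le_eqVlt; apply/orP; left; apply/eqP; congr (_ * _).
rewrite -sum1_card natr_sum big_mkcond [RHS]big_mkcond/=; apply: eq_bigr => i _.
by rewrite !inE; case: (theta i == j) => //=; case: (s (t i) == j).
Qed.

Lemma balanced_card (n k : nat) (theta : labeling n k) : (0 < k)%N ->
  balanced theta -> forall j, (#|community theta j| * k)%N = n.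
Proof.
move=> k0 bal j; apply/eqP; rewrite -(eqr_nat rat) natrM bal divfK//.
by rewrite pnatr_eq0 -lt0n.
Qed.

(** Here [x] stands for [e^(-eps)].  If [x <= 1] then [x^2 + x <= 2], and
otherwise [x^2 + x <= 2 x^2]: two terms of the right-hand side, which has
both as soon as [2 <= k]. *)
Lemma swap_slack_bound (R : realFieldType) (x delta k : R) :
  0 < x -> 0 <= delta -> k = 1 \/ 2 <= k ->
  (k - 1) * ((x ^+ 2 + x) * delta) <=
  2 * (k - 1) * delta * (1 + (k - 1) * x ^+ 2).
Proof.
move=> x0 d0 [->|k2]; first by rewrite subrr !(mul0r, mulr0).
suff : x ^+ 2 + x <= 2 * (1 + (k - 1) * x ^+ 2).
  have kd : 0 <= (k - 1) * delta by rewrite mulr_ge0//; lra.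
  by move=> /(ler_wpM2l kd); lra.
have x2 : 0 <= (k - 2) * x ^+ 2 by rewrite mulr_ge0 ?sqr_ge0//; lra.
by have := sqr_ge0 (x - 1); nra.
Qed.

Theorem proposition4 (R : realType) (d : measure_display)
    (T : measurableType d) (P : probability T R) (n k : nat)
    (theta : labeling n k) (M : 'M[bool]_n -> T -> labeling n k)
    (eps delta : R) :
  (6 : R) <= n%:R / k%:R ->
  balanced theta ->
  randomized_mechanism M ->
  symmetric_mechanism P M ->
  node_dp P M eps delta ->
  forall A : 'M[bool]_n, adjacency A ->
  forall xi : R, 0 < xi < 3^-1 ->
  (P [set w | (Ltilde R (M A w) theta <= xi)%R]
   <= (1 / ((1 - xi) * (1 + (k%:R - 1) * expR (- (2 * eps))))
       + 2 * (k%:R - 1) * delta / (1 - xi))%:E)%E.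
Proof.
move=> nk6 bal Mmeas Msym Mdp A adjA xi xi13.
have k0 : (0 < k)%N by case: k nk6 {theta M bal Mmeas Msym Mdp} => //; rewrite invr0 mulr0; lra.
have card := balanced_card k0 bal.
pose j0 := Ordinal k0; pose m := #|community theta j0|.
have card_m j : #|community theta j| = m.
  by apply/eqP; rewrite -(eqn_pmul2r k0) /m !card.
have large j : (6 <= #|community theta j|)%N.
  move: nk6; rewrite ler_pdivlMr ?ltr0n// -natrM ler_nat => k6n.
  by rewrite -(leq_pmul2r k0) card.
have bound := accurate_mass xi13 large (law_ge0 P M A) (law_total P Mmeas A)
  card_m (expR_ge0 _) (fun u v Q Q' => @law_swap _ _ _ P _ _ M Mmeas eps delta Mdp
     A u v Q Q' Msym adjA) k0.
apply: (@le_trans _ _ (P (M A @^-1` [set` accurate theta xi]))).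
  apply: le_measure; rewrite ?inE.
  - exact: (Mmeas A [set t | Ltilde R t theta <= xi]).
  - exact: Mmeas.
  - move=> w /= le_xi; apply: Ltilde_accurate le_xi => j.
    by apply: leq_trans (large j).
rewrite law_sum// lee_fin.
have delta0 := node_dp_delta_ge0 Mmeas Mdp adjA.
have k12 : (k%:R = 1 :> R) \/ (2 <= k%:R :> R).
  have [k1|k1] : (k = 1 \/ 1 < k)%N by lia.
    by left; rewrite k1.
  by right; rewrite ler_nat.
have slack := swap_slack_bound (expR_gt0 (- eps)) delta0 k12.
have g2 : expR (- eps) ^+ 2 = expR (- (2 * eps)).
  by rewrite expr2 -expRD; congr expR; ring.
rewrite g2 in slack.
have k1 : 0 <= k%:R - 1 :> R by case: k12 => [->|]; lra.
have D0 : 0 < 1 + (k%:R - 1) * expR (- (2 * eps)).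
  by have := mulr_ge0 k1 (expR_ge0 (- (2 * eps))); lra.
have X0 : 0 < 1 - xi by case/andP: xi13 => _; lra.
move: (\sum_(t in _) _) (expR (- (2 * eps))) D0 bound slack => p g D0 bound slack.
have -> : 1 / ((1 - xi) * (1 + (k%:R - 1) * g)) + 2 * (k%:R - 1) * delta / (1 - xi)
   = (1 + 2 * (k%:R - 1) * delta * (1 + (k%:R - 1) * g)) /
     ((1 - xi) * (1 + (k%:R - 1) * g)).
  by field; rewrite !gt_eqF.
rewrite ler_pdivlMr ?mulr_gt0//; lra.
Qed.
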